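(* 1. Every ccpBa (or c$\vee$cpBa) $\mathcal{A}$ is embeddable into the complex algebra $Up(\mathcal{F}_{\mathcal{A}})$ of the canonical frame $\mathcal{F}_{\mathcal{A}}$ of $\mathcal{A}$. 2. Every sub-normal frame (or sub-normal identity frame) $\mathcal{F}$ can be embedded into the canonical frame $\mathcal{F}_{Up(\mathcal{F})}$ of the complex algebra $Up(\mathcal{F})$ of $\mathcal{F}$.
   Context: A relatively pseudo-complemented (rpc) lattice is a lattice with a binary operation $\rightarrow$ satisfying $a\wedge x\leq b\Leftrightarrow x\leq a\rightarrow b$. A ccpBa is an algebra $(A,1,0,\vee,\wedge,\rightarrow,\neg,\sim)$ such that $(A,1,0,\vee,\wedge,\rightarrow)$ is a bounded rpc lattice and, for all $a\in A$, $\neg a=a\rightarrow 0$ and $\sim a=a\rightarrow(\neg\neg\sim 1)$. A c$\vee$cpBa is a ccpBa with $a\vee\sim a=1$ for all $a$. A sub-normal frame is $(W,\leq,Y_0)$ with $(W,\leq)$ a nonempty poset and $Y_0\subseteq W$ an upset such that for all $x\in W$: if for every $y\geq x$ there is $z\geq y$ with $z\in Y_0$, then $x\in Y_0$. It is a sub-normal identity frame if moreover for all $x,y\in W\setminus Y_0$, $x\leq y$ implies $y\leq x$. The complex algebra of $\mathcal{F}=(W,\leq,Y_0)$ is $Up(\mathcal{F})=(Up(W),W,\emptyset,\cup,\cap,\rightarrow,\neg,\sim)$, where $Up(W)$ is the set of upsets of $W$ and $U\rightarrow V=\{w:\forall v\geq w\,(v\in U\Rightarrow v\in V)\}$, $\neg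 U=U\rightarrow\emptyset$, $\sim U=U\rightarrow Y_0$; for a sub-normal (identity) frame it is a ccpBa (c$\vee$cpBa). The canonical frame of a ccpBa $\mathcal{A}$ is $\mathcal{F}_{\mathcal{A}}=(X_A,\subseteq,Y_0)$, where $X_A$ is the set of prime filters of $\mathcal{A}$ and $Y_0=\{P\in X_A:\ \sim1\in P\}$. An embedding of algebras is an order-preserving and order-reflecting map preserving all operations. An embedding of frames $(W,\leq,Y_0)\to(W',\leq',Y_0')$ is a map $f$ with $a\leq b\Leftrightarrow f(a)\leq'f(b)$ and $a\in Y_0\Leftrightarrow f(a)\in Y_0'$ for all $a,b\in W$. *)

(* Defs.v *)
From HB Require Import structures.
From mathcomp Require Import all_boot all_order.
From mathcomp Require Import boolp classical_sets.

Set Implicit Arguments.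
Unset Strict Implicit.
Unset Printing Implicit Defensive.

Import Order.TTheory.
Local Open Scope classical_set_scope.
Local Open Scope order_scope.

HB.mixin Record Lattice_isRPC (d : Order.disp_t) A of Order.Lattice d A := {
  imp : A -> A -> A;
  impP : forall a b x : A, (Order.meet a x <= b) = (x <= imp a b)
}.

#[short(type="rpcLatticeType")]
HB.structure Definition RPCLattice d := {A of Order.Lattice d A & Lattice_isRPC d A}.

#[short(type="tbRPCLatticeType")]
HB.structure Definition TBRPCLattice d :=
  {A of Order.TBLattice d A & Lattice_isRPC d A}.

HB.mixin Record TBRPCLattice_isCcpBa (d : Order.disp_t) A of TBRPCLattice d A := {
  neg : A -> A;
  sim : A -> A;
  negE : forall a : A, neg a = imp a \bot;
  simE : forall a : A, sim a = imp a (neg (neg (sim \top)))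
}.

#[short(type="ccpBaType")]
HB.structure Definition CcpBa d := {A of TBRPCLattice d A & TBRPCLattice_isCcpBa d A}.

HB.mixin Record CcpBa_isCVcpBa (d : Order.disp_t) A of CcpBa d A := {
  joinsim : forall a : A, Order.join a (sim a) = \top
}.

#[short(type="cvcpBaType")]
HB.structure Definition CVcpBa d := {A of CcpBa d A & CcpBa_isCVcpBa d A}.

Definition upset d (W : porderType d) (U : set W) : Prop :=
  forall x y, x <= y -> U x -> U y.

(* The order-theoretic part of the notion of sub-normal frame is kept apart
   from nonemptiness: the canonical frame of a one-element algebra is empty
   (see canonical_frame_nonempty below), and its complex algebra is still
   a ccpBa. *)
HB.mixin Record POrder_isPreSubNormal (d : Order.disp_t) W of Order.POrder d W := {
  Y0 : set W;
  upset_Y0 : upset Y0;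
  Y0_subnormal : forall x : W,
    (forall y, x <= y -> exists z, y <= z /\ Y0 z) -> Y0 x
}.

#[short(type="preSubNormalFrameType")]
HB.structure Definition PreSubNormalFrame d :=
  {W of Order.POrder d W & POrder_isPreSubNormal d W}.

HB.mixin Record PreSubNormalFrame_isIdentity (d : Order.disp_t) W
    of PreSubNormalFrame d W := {
  subnormal_identity : forall x y : W, ~ Y0 x -> ~ Y0 y -> x <= y -> y <= x
}.

#[short(type="preSubNormalIdentityFrameType")]
HB.structure Definition PreSubNormalIdentityFrame d :=
  {W of PreSubNormalFrame d W & PreSubNormalFrame_isIdentity d W}.

HB.mixin Record PreSubNormalFrame_isNonempty (d : Order.disp_t) W
    of PreSubNormalFrame d W := {
  frame_nonempty : exists x : W, True
}.

#[short(type="subNormalFrameType")]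
HB.structure Definition SubNormalFrame d :=
  {W of PreSubNormalFrame d W & PreSubNormalFrame_isNonempty d W}.

#[short(type="subNormalIdentityFrameType")]
HB.structure Definition SubNormalIdentityFrame d :=
  {W of SubNormalFrame d W & PreSubNormalFrame_isIdentity d W}.

Arguments Y0 {d s}.

(* The carrier of the complex algebra: the upsets of W. *)
Record complex_algebra d (W : porderType d) := ComplexAlgebra {
  upset_val :> set W;
  upset_valP : `[< upset upset_val >]
}.

HB.instance Definition _ d (W : porderType d) :=
  [isSub of complex_algebra W for @upset_val d W].
HB.instance Definition _ d (W : porderType d) :=
  [Choice of complex_algebra W by <:].

Definition upset_pred d (W : porderType d) : pred (set W) :=
  fun U => `[< upset U >].

Section UpsetLattice.
Variables (d : Order.disp_t) (W : porderType d).

Fact upset_meet_closed : {in @upset_pred d W &, forall U V, Order.meet U V \in @upset_pred d W}.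
Proof.
move=> U V /asboolP hU /asboolP hV; apply/asboolP => x y xy [Ux Vx].
by split; [exact: hU Ux | exact: hV Vx].
Qed.

Fact upset_join_closed : {in @upset_pred d W &, forall U V, Order.join U V \in @upset_pred d W}.
Proof.
move=> U V /asboolP hU /asboolP hV; apply/asboolP => x y xy [Ux|Vx].
- by left; exact: hU Ux.
- by right; exact: hV Vx.
Qed.

Fact upset_bot : (\bot : set W) \in @upset_pred d W.
Proof. by apply/asboolP. Qed.

Fact upset_top : (\top : set W) \in @upset_pred d W.
Proof. by apply/asboolP. Qed.

(* Inclusion order, with lattice operations computed in [set W]: the meet,
   join, bottom and top are intersection, union, set0 and setT. *)
HB.instance Definition _ := Order.SubChoice_isTBSubLattice.Build
  set_display (set W) (@upset_pred d W) set_display (complex_algebra W)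
  upset_meet_closed upset_join_closed upset_bot upset_top.

Lemma complex_algebra_leE (U V : complex_algebra W) :
  (U <= V) <-> (U `<=` V)%classic.
Proof. by rewrite -[U <= V]/((U : set W) <= (V : set W)) subsetEset. Qed.

Lemma upsetP (U : complex_algebra W) : upset U.
Proof. exact/asboolP/upset_valP. Qed.

Lemma complex_algebra_eqP (U V : complex_algebra W) :
  (forall x, upset_val U x <-> upset_val V x) -> U = V.
Proof. by move=> UV; apply/val_inj/seteqP; split=> x /UV. Qed.

Fact upset_imp_subproof (U V : set W) :
  `[< upset [set w | forall v, w <= v -> U v -> V v] >].
Proof. by apply/asboolP => x y xy h v /(le_trans xy); apply: h. Qed.

Definition upset_imp (U V : complex_algebra W) : complex_algebra W :=
  ComplexAlgebra (upset_imp_subproof U V).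

Fact upset_impP (U V X : complex_algebra W) :
  (Order.meet U X <= V) = (X <= upset_imp U V).
Proof.
apply/idP/idP => /complex_algebra_leE h; apply/complex_algebra_leE.
- by move=> x Xx v xv Uv; apply: h; split=> //; exact: upsetP Xx.
- by move=> x [Ux Xx]; exact: (h x Xx).
Qed.

HB.instance Definition _ :=
  Lattice_isRPC.Build set_display (complex_algebra W) upset_impP.

Lemma complex_algebra_impE (U V : complex_algebra W) :
  (imp U V : set W) = [set w | forall v, w <= v -> upset_val U v -> upset_val V v].
Proof. by []. Qed.

End UpsetLattice.

Section ComplexAlgebra.
Variables (d : Order.disp_t) (W : preSubNormalFrameType d).

Definition upset_Y0_elt : complex_algebra W :=
  ComplexAlgebra (introT (asboolP _) (@upset_Y0 d W)).

Definition upset_neg (U : complex_algebra W) : complex_algebra W :=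
  imp U \bot.

Definition upset_sim (U : complex_algebra W) : complex_algebra W :=
  imp U upset_Y0_elt.

Fact upset_negE U : upset_neg U = imp U \bot. Proof. by []. Qed.

Fact upset_simE U :
  upset_sim U = imp U (upset_neg (upset_neg (upset_sim \top))).
Proof.
rewrite /upset_sim; congr imp; apply: complex_algebra_eqP => x.
rewrite /upset_neg !complex_algebra_impE /=; split=> [Yx y xy h|h].
- have Yy : Y0 y by exact: upset_Y0 xy Yx.
  by case: (h y (lexx y)) => v yv _; exact: upset_Y0 yv Yy.
- apply: Y0_subnormal => y xy; apply: contrapT => nz.
  case: (h y xy) => v yv sv; apply: nz; exists v; split=> //.
  exact: sv v (lexx v) I.
Qed.

HB.instance Definition _ := TBRPCLattice_isCcpBa.Build set_display
  (complex_algebra W) upset_negE upset_simE.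

Lemma complex_algebra_negE (U : complex_algebra W) :
  (neg U : set W) = [set w | forall v, w <= v -> ~ upset_val U v].
Proof. by []. Qed.

Lemma complex_algebra_simE (U : complex_algebra W) :
  (sim U : set W) = [set w | forall v, w <= v -> upset_val U v -> Y0 v].
Proof. by []. Qed.

End ComplexAlgebra.

Section ComplexAlgebraIdentity.
Variables (d : Order.disp_t) (W : preSubNormalIdentityFrameType d).

Fact upset_joinsim (U : complex_algebra W) : Order.join U (sim U) = \top.
Proof.
apply: complex_algebra_eqP => x; split=> // _.
have [Ux|nUx] := pselect (upset_val U x); [by left|right].
suff: upset_val (sim U) x by [].
rewrite complex_algebra_simE => v xv Uv.
apply: contrapT => nYv; apply: nUx; apply: (upsetP _ Uv).
by apply: subnormal_identity (xv) => // Yx; apply: nYv; exact: upset_Y0 xv Yx.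
Qed.

HB.instance Definition _ := CcpBa_isCVcpBa.Build set_display
  (complex_algebra W) upset_joinsim.

End ComplexAlgebraIdentity.

Record is_filter d (A : tbLatticeType d) (F : set A) : Prop := IsFilter {
  filter_top : F \top;
  filter_meet : forall a b, F a -> F b -> F (Order.meet a b);
  filter_up : upset F
}.

Record is_prime_filter d (A : tbLatticeType d) (P : set A) : Prop :=
  IsPrimeFilter {
    prime_filter_filter : is_filter P;
    prime_filter_proper : ~ P \bot;
    prime_filter_join : forall a b, P (Order.join a b) -> P a \/ P b
  }.

(* The carrier of the canonical frame: the prime filters of A. *)
Record canonical_frame d (A : tbLatticeType d) := CanonicalFrame {
  prime_filter_val :> set A;
  prime_filter_valP : `[< is_prime_filter prime_filter_val >]
}.

HB.instance Definition _ d (A : tbLatticeType d) :=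
  [isSub of canonical_frame A for @prime_filter_val d A].
HB.instance Definition _ d (A : tbLatticeType d) :=
  [Choice of canonical_frame A by <:].
(* Prime filters are ordered by inclusion, the order of [set A]. *)
HB.instance Definition _ d (A : tbLatticeType d) :=
  [SubChoice_isSubPOrder of canonical_frame A by <: with set_display].

Lemma canonical_frame_leE d (A : tbLatticeType d) (P Q : canonical_frame A) :
  (P <= Q) <-> (P `<=` Q)%classic.
Proof. by rewrite -[P <= Q]/((P : set A) <= (Q : set A)) subsetEset. Qed.

Lemma prime_filterP d (A : tbLatticeType d) (P : canonical_frame A) :
  is_prime_filter P.
Proof. exact/asboolP/prime_filter_valP. Qed.

Lemma prime_filter_theorem d (A : tbRPCLatticeType d) (F : set A) (a : A) :
  is_filter F -> ~ F a ->
  exists2 P : canonical_frame A, (F `<=` P)%classic & ~ prime_filter_val P a.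
Proof.
move=> Ff nFa.
pose good (G : set A) := is_filter (F `|` G)%classic /\ ~ (F `|` G)%classic a.
have [|G [[Gf nGa] Gmax]] := @Zorn_bigcup A good.
  move=> C Cgood Ctot; split; last first.
    by case=> // -[G CG Ga]; case: (Cgood G CG) => _; apply; right.
  split.
  - by left; exact: filter_top Ff.
  - move=> x y [Fx|[G CG Gx]] [Fy|[H CH Hy]].
    + by left; exact: filter_meet.
    + have [Hf _] := Cgood H CH.
      have : (F `|` H)%classic (Order.meet x y)
        by apply: (filter_meet Hf); [left | right].
      by case=> ?; [left | right; exists H].
    + have [Hf _] := Cgood G CG.
      have : (F `|` G)%classic (Order.meet x y)
        by apply: (filter_meet Hf); [right | left].
      by case=> ?; [left | right; exists G].
    + wlog : x y G H CG CH Gx Hy / (G `<=` H)%classic.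
        move=> wl; have [GH|HG] := Ctot G H CG CH; first exact: (wl x y G H).
        by rewrite meetC; exact: (wl y x H G).
      move=> GH; have [Hf _] := Cgood H CH.
      have : (F `|` H)%classic (Order.meet x y)
        by apply: (filter_meet Hf); right=> //; exact: GH.
      by case=> ?; [left | right; exists H].
  - move=> x y xy [Fx|[G CG Gx]]; first by left; exact: filter_up Fx.
    have [Gf _] := Cgood G CG.
    have : (F `|` G)%classic y by apply: (filter_up Gf xy); right.
    by case=> ?; [left | right; exists G].
set M := (F `|` G)%classic in Gf nGa.
have ext b : ~ M b -> exists2 m, M m & Order.meet m b <= a.
  move=> nMb; pose N : set A := [set x | exists2 m, M m & Order.meet m b <= x].
  have MN : (M `<=` N)%classic by move=> m Mm; exists m => //; exact: leIl.
  have Nb : N b by exists \top; [exact: filter_top Gf | exact: leIr].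
  have FN : (F `|` N)%classic = N.
    by apply/seteqP; split=> [x [Fx|//]|x]; [apply: MN; left | right].
  have Nf : is_filter N.
    split; first by apply: MN; exact: filter_top Gf.
    - move=> x y [m Mm mx] [n Mn ny]; exists (Order.meet m n).
        exact: filter_meet.
      rewrite lexI; apply/andP; split.
        by apply: le_trans mx; apply: leI2 => //; exact: leIl.
      by apply: le_trans ny; apply: leI2 => //; exact: leIr.
    - by move=> x y xy [m Mm mx]; exists m => //; exact: le_trans xy.
  apply: contrapT => nNa; apply: (Gmax N); last by split; rewrite FN.
  split; first by move=> x Gx; apply: MN; right.
  by move=> NG; apply: nMb; right; exact: NG.
have Mprime : is_prime_filter M.
  split=> // [M0|b c Mbc]; first by apply/nGa/(filter_up Gf (le0x a)).
  apply: contrapT => /not_orP[/ext[m Mm ma] /ext[n Mn na]]; apply: nGa.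
  apply: (filter_up Gf) (filter_meet Gf (filter_meet Gf Mm Mn) Mbc).
  rewrite impP leUx -!impP; apply/andP; split.
    by apply: le_trans ma; apply: leI2 => //; exact: leIl.
  by apply: le_trans na; apply: leI2 => //; exact: leIr.
exists (CanonicalFrame (introT (asboolP _) Mprime)) => //.
by move=> x Fx; left.
Qed.

Section CanonicalFrame.
Variables (d : Order.disp_t) (A : ccpBaType d).

Definition canonical_Y0 : set (canonical_frame A) := [set P | prime_filter_val P (sim \top)].

Fact upset_canonical_Y0 : upset canonical_Y0.
Proof. by move=> P Q /canonical_frame_leE PQ; exact: PQ. Qed.

Fact canonical_Y0_subnormal (P : canonical_frame A) :
  (forall Q, P <= Q -> exists R, Q <= R /\ canonical_Y0 R) -> canonical_Y0 P.
Proof.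
set s : A := sim \top => h; apply: contrapT => nPs.
have Pf := prime_filter_filter (prime_filterP P).
have s2 : imp (neg s) \bot <= s.
  by rewrite -negE {2}/s simE -impP leIr.
pose F : set A := [set x | prime_filter_val P (imp (neg s) x)].
have Ff : is_filter F.
  split.
  - by apply: (filter_up Pf) (filter_top Pf); rewrite -impP lex1.
  - move=> a b Fa Fb; apply: (filter_up Pf) (filter_meet Pf Fa Fb).
    rewrite -impP lexI; apply/andP.
    by split; rewrite impP; [exact: leIl | exact: leIr].
  - move=> a b ab; apply: (filter_up Pf).
    by rewrite -impP; apply: le_trans ab; rewrite impP.
have nF0 : ~ F \bot by move=> /(filter_up Pf s2).
have [Q FQ _] := prime_filter_theorem Ff nF0.
have PQ : P <= Q.
  apply/canonical_frame_leE => x Px; apply: FQ.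
  by apply: (filter_up Pf) Px; rewrite -impP leIr.
have Qns : prime_filter_val Q (neg s).
  apply: FQ; apply: (filter_up Pf) (filter_top Pf).
  by rewrite -impP leIl.
have [R [/canonical_frame_leE QR Rs]] := h Q PQ.
have [Rf nR0 _] := prime_filterP R.
apply: nR0; apply: (filter_up Rf) (filter_meet Rf Rs (QR _ Qns)).
by rewrite impP negE.
Qed.

HB.instance Definition _ := POrder_isPreSubNormal.Build set_display
  (canonical_frame A) upset_canonical_Y0 canonical_Y0_subnormal.

Lemma canonical_frame_nonempty :
  (\bot : A) != \top <-> exists P : canonical_frame A, True.
Proof.
split=> [/eqP nt|[P _]]; last first.
  apply/eqP => bt; have [Pf nP0 _] := prime_filterP P.
  by apply: nP0; rewrite bt; exact: filter_top Pf.
have Tf : is_filter [set \top : A].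
  by split=> //= [a b -> ->|a b ab ea]; [exact: meetxx | apply/le_anti; rewrite lex1 -ea ab].
by have [P _ _] := prime_filter_theorem Tf nt; exists P.
Qed.

End CanonicalFrame.

Section CanonicalFrameIdentity.
Variables (d : Order.disp_t) (A : cvcpBaType d).

Fact canonical_identity (P Q : canonical_frame A) :
  ~ Y0 P -> ~ Y0 Q -> P <= Q -> Q <= P.
Proof.
move=> nP nQ /canonical_frame_leE PQ; apply/canonical_frame_leE => a Qa.
have [Pf _ Pp] := prime_filterP P.
have [//|Psa] : prime_filter_val P a \/ prime_filter_val P (sim a).
  by apply: Pp; rewrite joinsim; exact: filter_top.
have [Qf _ _] := prime_filterP Q.
exfalso; apply: nQ; apply: (filter_up Qf) (filter_meet Qf Qa (PQ _ Psa)).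
have -> : sim (\top : A) = neg (neg (sim \top)).
  apply/le_anti; apply/andP; split.
    by rewrite negE -impP negE meetC impP.
  by rewrite [leRHS]simE -impP leIr.
by rewrite impP simE.
Qed.

HB.instance Definition _ := PreSubNormalFrame_isIdentity.Build set_display
  (canonical_frame A) canonical_identity.

End CanonicalFrameIdentity.

Section CanonicalFrameOfComplexAlgebra.
Variables (d : Order.disp_t) (W : subNormalFrameType d).

Fact canonical_complex_nonempty :
  exists P : canonical_frame (complex_algebra W), True.
Proof.
apply/canonical_frame_nonempty/eqP => bt; have [x _] := @frame_nonempty d W.
by have : upset_val (\top : complex_algebra W) x by []; rewrite -bt.
Qed.

HB.instance Definition _ := PreSubNormalFrame_isNonempty.Build set_display
  (canonical_frame (complex_algebra W)) canonical_complex_nonempty.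

End CanonicalFrameOfComplexAlgebra.

HB.instance Definition _ d (W : subNormalIdentityFrameType d) :=
  SubNormalFrame.on (canonical_frame (complex_algebra W)).

Record algebra_embedding d d' (A : ccpBaType d) (B : ccpBaType d') (f : A -> B)
    : Prop := AlgebraEmbedding {
  algebra_embedding_le : forall a b, (a <= b) <-> (f a <= f b);
  algebra_embedding_top : f \top = \top;
  algebra_embedding_bot : f \bot = \bot;
  algebra_embedding_join : forall a b,
    f (Order.join a b) = Order.join (f a) (f b);
  algebra_embedding_meet : forall a b,
    f (Order.meet a b) = Order.meet (f a) (f b);
  algebra_embedding_imp : forall a b, f (imp a b) = imp (f a) (f b);
  algebra_embedding_neg : forall a, f (neg a) = neg (f a);
  algebra_embedding_sim : forall a, f (sim a) = sim (f a)
}.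

Record frame_embedding d d' (W : preSubNormalFrameType d)
    (W' : preSubNormalFrameType d') (f : W -> W') : Prop := FrameEmbedding {
  frame_embedding_le : forall a b, (a <= b) <-> (f a <= f b);
  frame_embedding_Y0 : forall a, Y0 a <-> Y0 (f a)
}.

Definition algebra_embeddable d d' (A : ccpBaType d) (B : ccpBaType d') : Prop :=
  exists f : A -> B, algebra_embedding f.

Definition frame_embeddable d d' (W : preSubNormalFrameType d)
    (W' : preSubNormalFrameType d') : Prop :=
  exists f : W -> W', frame_embedding f.

(* Main.v *)
(** The embedding of an algebra is the Stone map, sending [a] to the set of
    prime filters containing [a]; the prime filter theorem makes it reflect the
    order and preserve [imp]. Since [sim \top] is regular, [sim a] is
    [imp a (sim \top)], and the Stone map sends [sim \top] to [Y0], so that [sim]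
    is preserved as well. The embedding of a frame sends a point to the prime
    filter of the upsets containing it; it reflects the order because principal
    upsets separate points. *)
Require Import Defs.
From HB Require Import structures.
From mathcomp Require Import all_boot all_order.
From mathcomp Require Import boolp classical_sets.

Set Implicit Arguments.
Unset Strict Implicit.
Unset Printing Implicit Defensive.

Import Order.TTheory.
Local Open Scope classical_set_scope.
Local Open Scope order_scope.

Section RPC.
Variables (d : Order.disp_t) (A : tbRPCLatticeType d).

Lemma imp1x (a : A) : imp \top a = a.
Proof.
apply/le_anti/andP; split; last by rewrite -impP leIr.
by rewrite -[leLHS]meet1x impP.
Qed.

Lemma is_filter_principal (a : A) : is_filter [set x | a <= x].
Proof.
split=> /= [|x y ax ay|x y xy ax]; first exact: lex1.
- by rewrite lexI ax.
- exact: le_trans xy.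
Qed.

(** By residuation [imp a x] lies in [F] exactly when [x] is above a meet of [a] with some element
    of [F], so this set is the filter generated by [F] and [a]. *)
Lemma is_filter_imp (F : set A) (a : A) :
  is_filter F -> is_filter [set x | F (imp a x)].
Proof.
case=> F1 Fm Fu; split=> /= [|x y Fx Fy|x y xy]; first 1 last.
- apply: (Fu _ _ _ (Fm _ _ Fx Fy)).
  by rewrite -impP lexI; apply/andP; split; rewrite impP ?leIl ?leIr.
- by apply: Fu; rewrite -impP; apply: le_trans xy; rewrite impP.
- by apply: (Fu _ _ _ F1); rewrite -impP lex1.
Qed.

Fact stone_subproof (a : A) :
  `[< upset [set P : canonical_frame A | prime_filter_val P a] >].
Proof. by apply/asboolP => P Q /canonical_frame_leE PQ; exact: PQ. Qed.

Definition stone (a : A) : complex_algebra (canonical_frame A) :=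
  ComplexAlgebra (stone_subproof a).

Lemma stone_le (a b : A) : (a <= b) <-> (stone a <= stone b).
Proof.
rewrite complex_algebra_leE; split=> [ab P|sab].
  exact: (filter_up (prime_filter_filter (prime_filterP P)) ab).
apply: contrapT => nab.
have [P aP nPb] := prime_filter_theorem (is_filter_principal a) nab.
by apply/nPb/sab/aP => /=.
Qed.

Lemma stone_top : stone \top = \top.
Proof.
apply: complex_algebra_eqP => P; split=> // _.
exact: (filter_top (prime_filter_filter (prime_filterP P))).
Qed.

Lemma stone_bot : stone \bot = \bot.
Proof.
apply: complex_algebra_eqP => P; split=> // P0.
by case: (prime_filter_proper (prime_filterP P)).
Qed.

Lemma stone_join (a b : A) :
  stone (Order.join a b) = Order.join (stone a) (stone b).
Proof.
apply: complex_algebra_eqP => P; have [Pf _ Pj] := prime_filterP P.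
split=> [/Pj//|[]]; apply: (filter_up Pf); [exact: leUl | exact: leUr].
Qed.

Lemma stone_meet (a b : A) :
  stone (Order.meet a b) = Order.meet (stone a) (stone b).
Proof.
apply: complex_algebra_eqP => P; have [Pf _ _] := prime_filterP P.
split=> [Pab|[Pa Pb]]; last exact: (filter_meet Pf).
by split; apply: (filter_up Pf) Pab; [exact: leIl | exact: leIr].
Qed.

Lemma stone_imp (a b : A) : stone (imp a b) = imp (stone a) (stone b).
Proof.
apply: complex_algebra_eqP => P; rewrite complex_algebra_impE /=.
split=> [Pab Q /canonical_frame_leE PQ Qa|h].
  have [Qf _ _] := prime_filterP Q.
  by apply: (filter_up Qf) (filter_meet Qf Qa (PQ _ Pab)); rewrite impP.
(* If [imp a b] is not in [P], the filter generated by [P] and [a] omits [b]; a prime [Q] extending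
   it and omitting [b] contradicts [h]. *)
apply: contrapT => nPab; have [Pf _ _] := prime_filterP P.
have [Q PQ nQb] := prime_filter_theorem (is_filter_imp a Pf) nPab.
apply/nQb/h; last first.
  by apply/PQ/(filter_up Pf _ (filter_top Pf)); rewrite -impP leIl.
apply/canonical_frame_leE => x Px; apply: PQ.
by apply: (filter_up Pf) Px; rewrite -impP leIr.
Qed.

End RPC.

Section CcpBa.
Variables (d : Order.disp_t) (A : ccpBaType d).

(** The axiom for [sim] taken at [\top] shows that [sim \top] equals its own double negation. *)
Lemma sim_imp (a : A) : sim a = imp a (sim \top).
Proof. by rewrite simE [in RHS]simE imp1x. Qed.

Lemma stone_sim (a : A) : stone (sim a) = sim (stone a).
(* [stone (sim \top)] and the [Y0] of the canonical frame are the same set by definition. *)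
Proof. by rewrite sim_imp stone_imp; apply: complex_algebra_eqP. Qed.

Lemma stone_embedding : algebra_embedding (@stone d A).
Proof.
split; [exact: stone_le | exact: stone_top | exact: stone_bot
  | exact: stone_join | exact: stone_meet | exact: stone_imp | |
  exact: stone_sim].
by move=> a; rewrite !negE stone_imp stone_bot.
Qed.

End CcpBa.

Section Point.
Variables (d : Order.disp_t) (W : porderType d).

Fact point_filter_subproof (x : W) :
  `[< is_prime_filter [set U : complex_algebra W | upset_val U x] >].
Proof.
apply/asboolP; split=> //; split=> // U V /complex_algebra_leE; exact.
Qed.

Definition point_filter (x : W) : canonical_frame (complex_algebra W) :=
  CanonicalFrame (point_filter_subproof x).

Fact principal_upset_subproof (x : W) : `[< upset [set y | x <= y] >].
Proof. by apply/asboolP => y z yz /= /le_trans; apply. Qed.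

Definition principal_upset (x : W) : complex_algebra W :=
  ComplexAlgebra (principal_upset_subproof x).

Lemma point_filter_le (x y : W) :
  (x <= y) <-> (point_filter x <= point_filter y).
Proof.
rewrite canonical_frame_leE; split=> [xy U|/(_ (principal_upset x))].
  exact: upsetP.
(* By reflexivity [principal_upset x] is in [point_filter x], hence in [point_filter y]. *)
by apply=> /=.
Qed.

End Point.

Lemma point_filter_embedding d (W : preSubNormalFrameType d) :
  frame_embedding (@point_filter d W).
Proof.
split; first exact: point_filter_le.
(* [point_filter x] is in [Y0] when [sim \top] contains [x], that is, when every [y] above [x] lies
   in [Y0]. *)
move=> x; split=> [Yx y xy _|]; first exact: upset_Y0 xy Yx.
by apply.
Qed.

Theorem theorem7p4 :
  ((forall (d : Order.disp_t) (A : ccpBaType d),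
      algebra_embeddable A (complex_algebra (canonical_frame A))) /\
   (forall (d : Order.disp_t) (A : cvcpBaType d),
      algebra_embeddable A
        (complex_algebra (canonical_frame A) : cvcpBaType set_display))) /\
  ((forall (d : Order.disp_t) (F : subNormalFrameType d),
      frame_embeddable F
        (canonical_frame (complex_algebra F)
           : subNormalFrameType set_display)) /\
   (forall (d : Order.disp_t) (F : subNormalIdentityFrameType d),
      frame_embeddable F
        (canonical_frame (complex_algebra F)
           : subNormalIdentityFrameType set_display))).
Proof.
split; split=> d X.
- by exists (@stone d X); exact: stone_embedding.
(* The same map serves: the extra law of the target is carried by its type. *)
- by exists (@stone d X); exact: stone_embedding.
- by exists (@point_filter d X); exact: point_filter_embedding.
- by exists (@point_filter d X); exact: point_filter_embedding.
Qed.
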